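(* Let $\delta\in(0,1/2)$ and let $\mathcal{G}$ be a class of functions $\mathcal{Z}\to[-1,1]$. For any $[0,1]$-valued tree $\mathbf{p}$ of depth $n$, any $\mathcal{Z}$-valued tree $\mathbf{z}$ of depth $n$, any $K>0$ and any $\gamma>0$, $$\mathbb{E}\sup_{g\in\mathcal{G}}\Big[\sum_{t:\,\mathbf{p}_t(y)\in[\delta,1-\delta]}\eta(\mathbf{p}_t(y),y_t)g(\mathbf{z}_t(y))-Kg(\mathbf{z}_t(y))^2\Big]\le\frac1\delta\frac{\log\mathcal{N}_\infty(\mathcal{G},\gamma,\mathbf{z})}{\log(1+\frac K8)}+\inf_{\alpha\in(0,\gamma]}\Big\{\frac{4n\alpha}{\delta}+30\sqrt{\frac{2n}{\delta}}\int_\alpha^\gamma\sqrt{\log\mathcal{N}_\infty(\mathcal{G},\rho,\mathbf{z})}\,d\rho+\frac8\delta\int_\alpha^\gamma\log\mathcal{N}_\infty(\mathcal{G},\rho,\mathbf{z})\,d\rho\Big\},$$ where the process $y_1,\dots,y_n$ is defined by $y_t\mid y_1,\dots,y_{t-1}\sim\mathrm{Bernoulli}(\mathbf{p}_t(y_1,\dots,y_{t-1}))$.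
   Context: A $\mathcal{Z}$-valued tree $\mathbf{z}$ of depth $n$ is a sequence of maps $\mathbf{z}_t:\{0,1\}^{t-1}\to\mathcal{Z}$, $t=1,\dots,n$; for $y\in\{0,1\}^n$, $\mathbf{z}_t(y)=\mathbf{z}_t(y_1,\dots,y_{t-1})$. $\eta(p,a)=-\mathbf{1}\{a=1\}p^{-1}+\mathbf{1}\{a=0\}(1-p)^{-1}$. Sequential covering number: a set $V$ of $\mathbb{R}$-valued trees of depth $n$ is a sequential $\gamma$-cover (in $\ell_\infty$) of $\mathcal{G}\subseteq\mathbb{R}^{\mathcal{Z}}$ on $\mathbf{z}$ if for every $g\in\mathcal{G}$ and every $y\in\{0,1\}^n$ there is $\mathbf{v}\in V$ with $\max_{1\le t\le n}|\mathbf{v}_t(y)-g(\mathbf{z}_t(y))|\le\gamma$; $\mathcal{N}_\infty(\mathcal{G},\gamma,\mathbf{z})$ denotes the size of the smallest such cover. *)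

(* Defs.v *)
From HB Require Import structures.
From mathcomp Require Import all_boot all_order all_algebra.
From mathcomp Require Import all_classical all_reals all_analysis.
Set Implicit Arguments. Unset Strict Implicit. Unset Printing Implicit Defensive.
Import Order.TTheory GRing.Theory Num.Theory.
Local Open Scope classical_set_scope.
Local Open Scope ring_scope.

(* A T-valued tree of depth n: t |-> (prefix y_1..y_{t-1} |-> value).
   We index time from 0: [tr t (take t y)] is the paper's z_{t+1}(y). *)
Definition tree (T : Type) := nat -> seq bool -> T.

Section Defs.
Variable R : realType.

Definition etaB (p : R) (a : bool) : R := if a then - p^-1 else (1 - p)^-1.

Definition path_prob (n : nat) (p : tree R) (y : n.-tuple bool) : R :=
  \prod_(t < n) (if tnth y t then p t (take t y) else 1 - p t (take t y)).

Definition Ep (n : nat) (p : tree R) (f : n.-tuple bool -> R) : R :=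
  \sum_(y : n.-tuple bool) path_prob p y * f y.

Definition seq_cover {Z : Type} (n : nat) (G : set (Z -> R)) (gamma : R)
  (z : tree Z) (V : seq (tree R)) : Prop :=
  forall g, G g -> forall y : n.-tuple bool,
    exists2 v, v \in V &
      forall t : 'I_n, `| v t (take t y) - g (z t (take t y)) | <= gamma.

Definition covN {Z : Type} (n : nat) (G : set (Z -> R)) (gamma : R)
  (z : tree Z) : R :=
  inf [set (size V)%:R | V in [set V | seq_cover n G gamma z V]].

End Defs.

(* Main.v *)
Require Import Defs.
From HB Require Import structures.
From mathcomp Require Import all_boot all_order all_algebra.
From mathcomp Require Import all_classical all_reals all_analysis.
From mathcomp Require Import ring lra.
Import Order.TTheory GRing.Theory Num.Theory.
Local Open Scope classical_set_scope.
Local Open Scope ring_scope.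

(* For a fixed tree [w], the sums of [eta(p_t, y_t) w_t] form a martingale whose
   increments are bounded by [|w_t| / delta] and have conditional variance at
   most [2 w_t^2 / delta], so exponential moments control finite families of
   trees.  At the coarsest scale [gamma] the covering trees are soft-thresholded
   by [gamma]: they are then dominated in absolute value by the function they
   approximate, the negative quadratic term passes to them, and the
   exponential moment at [lambda = delta ln (1 + K / 8)] is at most [1].  The
   rest is chained along the scales [gamma / 2^k]; the differences of covering
   trees at successive scales are clipped, which keeps them predictable and does
   not change them on the path where they are used.  The chain stops at the
   scale [alpha], where [E |eta| = 2] bounds the remainder. *)

(** * Elementary bounds on the exponential *)

Lemma expR_sub1_chord {R : realType} (x b : R) : 0 <= x <= b ->
  b * (expR x - 1) <= x * (expR b - 1).
Proof.
move=> /andP[x0 xb].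
have h1 : expR x * (1 + (b - x)) <= expR b.
  rewrite [leRHS](_ : _ = expR x * expR (b - x)); last first.
    by rewrite -expRD; congr expR; ring.
  by rewrite ler_pM2l ?expR_gt0// expR_ge1Dx.
have h2 : expR x * (1 - x) <= 1.
  by rewrite -[leRHS](expRxMexpNx_1 x) ler_pM2l ?expR_gt0// expR_ge1Dx.
(* The tangent to the exponential at [x], evaluated at [b] and at [0], is used with weights [x] and
   [b - x]. *)
have := mulr_ge0 x0 (_ : 0 <= expR b - expR x * (1 + (b - x))).
have := mulr_ge0 (_ : 0 <= b - x) (_ : 0 <= 1 - expR x * (1 - x)).
rewrite !subr_ge0 => /(_ xb h2) h3 /(_ h1) h4; nra.
Qed.

(** Since [expR x - 1 - x <= x * (expR x - 1)], the chord bound settles [x >= 0]; for [x < 0] any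
    coefficient at least 1 suffices. The coefficient is kept exact because at [b = ln (1 + K / 8)]
    it equals [K / (8 * b)]. *)
Lemma expR_le_quadratic {R : realType} (x b : R) : 0 < b -> x <= b ->
  expR x <= 1 + x + x ^+ 2 * ((expR b - 1) / b).
Proof.
move=> b0 xb.
have h2 : expR x * (1 - x) <= 1.
  by rewrite -[leRHS](expRxMexpNx_1 x) ler_pM2l ?expR_gt0// expR_ge1Dx.
suff : x * (expR x - 1) <= x ^+ 2 * ((expR b - 1) / b) by lra.
have [x0|x0] := leP 0 x.
  rewrite expr2 -mulrA ler_wpM2l// mulrA ler_pdivlMr// mulrC.
  by apply: expR_sub1_chord; rewrite x0.
apply: (@le_trans _ _ (x ^+ 2)).
  rewrite expr2 ler_nM2l//; have := expR_ge1Dx x; lra.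
rewrite ler_peMr ?sqr_ge0// ler_pdivlMr// mul1r.
have := expR_ge1Dx b; lra.
Qed.

(** The value [11 / 2] makes [(expR b - 1) / b] at most 3 at [b = 3 / 2]. The 12th power of
    [expR (- (1 / 8)) >= 7 / 8] is precise enough. *)
Lemma expR_three_halves_le {R : realType} : expR (3 / 2) <= 11 / 2 :> R.
Proof.
have h : (7 / 8) ^+ 12 <= expR (- (1 / 8)) ^+ 12 :> R.
  by rewrite lerXn2r ?nnegrE ?expR_ge0//; have := expR_ge1Dx (- (1 / 8) : R); lra.
have e : expR (- (1 / 8)) ^+ 12 * expR (3 / 2) = 1 :> R.
  by rewrite -expRM_natl -expRD -[RHS]expR0; congr expR; field.
have := expR_gt0 (3 / 2 : R); nra.
Qed.

(** * Expectation along the random path and exponential moments *)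

Section Expectation.
Context {R : realType}.

Definition prob_tree (n : nat) (p : tree R) : Prop :=
  forall (t : nat) (s : seq bool), (t < n)%N -> size s = t -> 0 <= p t s <= 1.

(** What remains of a tree after a first outcome [b]; inductions on the depth condition on the first
    outcome rather than the last. *)
Definition subtree {T : Type} (b : bool) (p : tree T) : tree T :=
  fun t s => p t.+1 (b :: s).

Lemma prob_subtree n p b : prob_tree n.+1 p -> prob_tree n (subtree b p).
Proof. by move=> hp t s tn st; apply: hp => //=; rewrite st. Qed.

Lemma sum_tuple_cons n (f : n.+1.-tuple bool -> R) :
  \sum_(y : n.+1.-tuple bool) f y =
  \sum_(y : n.-tuple bool) f [tuple of true :: y] +
  \sum_(y : n.-tuple bool) f [tuple of false :: y].
Proof.
rewrite (reindex (fun u : bool * n.-tuple bool => [tuple of u.1 :: u.2])) /=.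
  rewrite -(pair_big xpredT xpredT
    (fun (b : bool) (y : n.-tuple bool) => f [tuple of b :: y]))/=.
  by rewrite big_bool.
exists (fun y => (thead y, [tuple of behead y])) => [[b y] _|y _] /=.
  by rewrite theadE; congr pair; apply: val_inj.
by rewrite -tuple_eta.
Qed.

Lemma path_prob_cons n (p : tree R) b (y : n.-tuple bool) :
  path_prob p [tuple of b :: y] =
  (if b then p 0%N [::] else 1 - p 0%N [::]) * path_prob (subtree b p) y.
Proof.
rewrite /path_prob big_ord_recl/= tnth0; congr (_ * _).
by apply: eq_bigr => i _; rewrite tnthS.
Qed.

Lemma Ep_cons n (p : tree R) (f : n.+1.-tuple bool -> R) :
  Ep p f = p 0%N [::] * Ep (subtree true p) (fun y => f [tuple of true :: y])
   + (1 - p 0%N [::]) * Ep (subtree false p) (fun y => f [tuple of false :: y]).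
Proof.
rewrite /Ep sum_tuple_cons !mulr_sumr; congr (_ + _);
  by apply: eq_bigr => y _; rewrite path_prob_cons mulrA.
Qed.

Lemma Ep0 (p : tree R) (f : 0.-tuple bool -> R) : Ep p f = f [tuple].
Proof.
rewrite /Ep (eq_bigr (fun _ => f [tuple])) => [|y _].
  by rewrite big_const card_tuple expn0 /= addr0.
by rewrite /path_prob big_ord0 mul1r tuple0.
Qed.

Lemma path_prob_ge0 n (p : tree R) (y : n.-tuple bool) :
  prob_tree n p -> 0 <= path_prob p y.
Proof.
move=> hp; apply: prodr_ge0 => t _.
have st : size (take t y) = t by rewrite size_takel// size_tuple ltnW.
have /andP[? ?] := hp t (take t y) (ltn_ord t) st.
by case: ifP => _ //; rewrite subr_ge0.
Qed.

Lemma le_Ep n (p : tree R) (f g : n.-tuple bool -> R) : prob_tree n p ->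
  (forall y, f y <= g y) -> Ep p f <= Ep p g.
Proof.
move=> hp fg; apply: ler_sum => y _.
by apply: ler_wpM2l => //; exact: path_prob_ge0.
Qed.

Lemma EpD n (p : tree R) (f g : n.-tuple bool -> R) :
  Ep p (fun y => f y + g y) = Ep p f + Ep p g.
Proof. by rewrite /Ep -big_split; apply: eq_bigr => y _; rewrite mulrDr. Qed.

Lemma EpZ n (p : tree R) c (f : n.-tuple bool -> R) :
  Ep p (fun y => c * f y) = c * Ep p f.
Proof. by rewrite /Ep mulr_sumr; apply: eq_bigr => y _; rewrite mulrCA. Qed.

Lemma Ep_sum n (p : tree R) (I : Type) (r : seq I) (f : I -> n.-tuple bool -> R) :
  Ep p (fun y => \sum_(i <- r) f i y) = \sum_(i <- r) Ep p (f i).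
Proof.
by rewrite /Ep exchange_big/=; apply: eq_bigr => y _; rewrite mulr_sumr.
Qed.

Lemma Ep_cst n (p : tree R) (c : R) : Ep p (fun _ : n.-tuple bool => c) = c.
Proof.
elim: n p => [|n IH] p; first by rewrite Ep0.
by rewrite Ep_cons !IH; ring.
Qed.

(** The partial products form a supermartingale started at 1: given the first outcome, induction in
    the subtree bounds the mean of the remaining product by 1. *)
Lemma Ep_prod_le1 n (p : tree R) (h : tree (bool -> R)) : prob_tree n p ->
  (forall t s b, 0 <= h t s b) ->
  (forall t s, p t s * h t s true + (1 - p t s) * h t s false <= 1) ->
  Ep p (fun y : n.-tuple bool => \prod_(t < n) h t (take t y) (tnth y t)) <= 1.
Proof.
elim: n p h => [|n IH] p h hp h0 h1; first by rewrite Ep0 big_ord0.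
rewrite Ep_cons; apply: le_trans (h1 0%N [::]).
have /andP[p0 p1] := hp 0%N [::] isT erefl.
have step b : Ep (subtree b p) (fun y : n.-tuple bool =>
    \prod_(t < n.+1) h t (take t (b :: y)) (tnth [tuple of b :: y] t))
    <= h 0%N [::] b.
  have -> : (fun y : n.-tuple bool =>
    \prod_(t < n.+1) h t (take t (b :: y)) (tnth [tuple of b :: y] t)) =
    (fun y => h 0%N [::] b *
       \prod_(t < n) subtree b h t (take t y) (tnth y t)).
    apply/funext => y; rewrite big_ord_recl tnth0; congr (_ * _).
    by apply: eq_bigr => i _; rewrite tnthS.
  rewrite EpZ ler_piMr// IH => // [|t s c|t s]; first exact: prob_subtree.
    exact: h0.
  exact: h1.
by apply: lerD; apply: ler_wpM2l; rewrite ?subr_ge0// step.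
Qed.

Lemma Ep_expR_sum_le n (p : tree R) (X : tree (bool -> R)) (k : R) :
  prob_tree n p ->
  (forall t s, p t s * expR (X t s true) + (1 - p t s) * expR (X t s false)
               <= expR k) ->
  Ep p (fun y : n.-tuple bool => expR (\sum_(t < n) X t (take t y) (tnth y t)))
    <= expR (n%:R * k).
Proof.
move=> hp hX.
(* Rescaling each factor by [expR (- k)] brings its conditional mean to at most 1. *)
have := @Ep_prod_le1 n p (fun t s b => expR (- k) * expR (X t s b)) hp.
have -> : (fun y : n.-tuple bool =>
    \prod_(t < n) (expR (- k) * expR (X t (take t y) (tnth y t)))) =
  (fun y => expR (- (n%:R * k)) * expR (\sum_(t < n) X t (take t y) (tnth y t))).
  apply/funext => y; rewrite big_split/= expR_sum; congr (_ * _).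
  by rewrite prodr_const card_ord -expRM_natl mulrN.
rewrite EpZ => h.
suff h1 : forall t s, p t s * (expR (- k) * expR (X t s true)) +
    (1 - p t s) * (expR (- k) * expR (X t s false)) <= 1.
  have := h (fun t s b => mulr_ge0 (expR_ge0 _) (expR_ge0 _)) h1.
  by rewrite expRN ler_pdivrMl ?expR_gt0// mulr1.
move=> t s; rewrite mulrCA (mulrCA (1 - _)) -mulrDr.
by rewrite -[leRHS](expRxMexpNx_1 k) mulrC ler_pM2r ?expR_gt0.
Qed.

Lemma Ep_sum_le n (p : tree R) (h : tree (bool -> R)) c : prob_tree n p ->
  (forall t s, p t s * h t s true + (1 - p t s) * h t s false <= c) ->
  Ep p (fun y : n.-tuple bool => \sum_(t < n) h t (take t y) (tnth y t))
    <= n%:R * c.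
Proof.
elim: n p h => [|n IH] p h hp h1; first by rewrite Ep0 big_ord0 mul0r.
rewrite Ep_cons -natr1 mulrDl mul1r addrC.
have /andP[p0 p1] := hp 0%N [::] isT erefl.
have step b : Ep (subtree b p) (fun y : n.-tuple bool =>
    \sum_(t < n.+1) h t (take t (b :: y)) (tnth [tuple of b :: y] t))
    <= h 0%N [::] b + n%:R * c.
  have -> : (fun y : n.-tuple bool =>
    \sum_(t < n.+1) h t (take t (b :: y)) (tnth [tuple of b :: y] t)) =
    (fun y => h 0%N [::] b +
       \sum_(t < n) subtree b h t (take t y) (tnth y t)).
    apply/funext => y; rewrite big_ord_recl tnth0; congr (_ + _).
    by apply: eq_bigr => i _; rewrite tnthS.
  rewrite EpD Ep_cst lerD2l; apply: IH => [|t s]; first exact: prob_subtree.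
  exact: h1.
have := step true; have := step false => sf st.
have q0 : 0 <= 1 - p 0%N [::] by rewrite subr_ge0.
have := ler_wpM2l p0 st; have := ler_wpM2l q0 sf; have := h1 0%N [::]; lra.
Qed.

(* [log u <= u - 1] bounds every [X i] by one explicit variable: no maximum
   over the family and no Jensen inequality is needed. *)
Lemma soft_max n (p : tree R) (I : eqType) (r : seq I)
    (X : I -> n.-tuple bool -> R) (lam L B : R) :
  prob_tree n p -> 0 < lam -> (size r)%:R <= expR L ->
  (forall i, i \in r -> Ep p (fun y => expR (lam * X i y)) <= expR B) ->
  exists2 M : n.-tuple bool -> R,
    (forall i, i \in r -> forall y, X i y <= M y) & Ep p M <= (L + B) / lam.
Proof.
move=> hp lam0 rL XB.
exists (fun y => lam^-1 * ((L + B - 1) +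
                   \sum_(i <- r) expR (- (L + B)) * expR (lam * X i y))).
  move=> i ir y; rewrite ler_pdivlMl//.
  have h1 : lam * X i y <= L + B - 1 + expR (- (L + B)) * expR (lam * X i y).
    rewrite -expRD; have := expR_ge1Dx (- (L + B) + lam * X i y); lra.
  apply: (le_trans h1); rewrite lerD2l (big_rem i ir)/= lerDl.
  by apply: sumr_ge0 => j _; rewrite mulr_ge0 ?expR_ge0.
rewrite EpZ EpD Ep_cst Ep_sum mulrC ler_pM2r ?invr_gt0//.
suff : \sum_(i <- r) Ep p (fun y => expR (- (L + B)) * expR (lam * X i y)) <= 1 by lra.
apply: (@le_trans _ _ (\sum_(i <- r) expR (- L))).
  rewrite big_seq [leRHS]big_seq; apply: ler_sum => i ir.
  rewrite EpZ (_ : - L = - (L + B) + B); last by ring.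
  by rewrite expRD ler_pM2l ?expR_gt0// XB.
rewrite big_const_seq count_predT iter_addr_0 -mulr_natl -[leRHS](expRxMexpNx_1 L).
by rewrite ler_pM2r ?expR_gt0.
Qed.

End Expectation.

(** * Sequential covers and covering numbers *)

Section Covering.
Context {R : realType} {Z : Type} {n : nat} {G : set (Z -> R)} {z : tree Z}.

Lemma grid_approx (rho x : R) : 0 < rho -> -1 <= x <= 1 ->
  exists i : 'I_(Num.truncn (2 / rho)).+1, `|(-1 + i%:R * rho) - x| <= rho.
Proof.
move=> rho0 /andP[x1 x2].
have u0 : 0 <= (x + 1) / rho by rewrite divr_ge0 ?(ltW rho0)//; lra.
have /andP[h1 h2] := truncn_itv u0.
have hlt : (Num.truncn ((x + 1) / rho) < (Num.truncn (2 / rho)).+1)%N.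
  by rewrite ltnS; apply: le_truncn; rewrite ler_pM2r ?invr_gt0//; lra.
exists (Ordinal hlt) => /=.
move: h1 h2; rewrite ler_pdivlMr// ltr_pdivrMr// -natr1 => h1 h2.
by rewrite ler_norml; apply/andP; split; lra.
Qed.

Hypothesis G1 : forall g, G g -> forall x, -1 <= g x <= 1.

(* Trees that ignore the path suffice, since the covering element may be
   chosen after the whole path. *)
Lemma seq_cover_exists (rho : R) : 0 < rho -> exists V, seq_cover n G rho z V.
Proof.
move=> rho0; pose m := (Num.truncn (2 / rho)).+1.
pose v (k : n.-tuple 'I_m) : tree R :=
  fun t _ => -1 + (nth ord0 k t : 'I_m)%:R * rho.
exists [seq v k | k <- enum {: n.-tuple 'I_m}] => g Gg y.
have /choice[k hk] : forall t : 'I_n, exists i : 'I_m,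
    `|(-1 + i%:R * rho) - g (z t (take t y))| <= rho.
  by move=> t; exact: grid_approx rho0 (G1 _ Gg _).
exists (v [tuple k t | t < n]); first by apply: map_f; rewrite mem_enum.
by move=> t; rewrite /v -tnth_nth tnth_mktuple; exact: hk.
Qed.

(** Cover sizes are natural numbers and some finite cover exists, so the infimum is a minimum and an
    optimal cover can be picked at each scale. *)
Lemma covN_attained (rho : R) : 0 < rho ->
  exists2 V, seq_cover n G rho z V & covN n G rho z = (size V)%:R.
Proof.
move=> rho0.
pose P k := `[< exists2 V, seq_cover n G rho z V & size V = k >].
have exP : exists k, P k.
  by have [V hV] := seq_cover_exists _ rho0; exists (size V); apply/asboolP; exists V.
have [m /asboolP[V hV Vm] mmin] := ex_minnP exP.
exists V => //; rewrite Vm; apply/le_anti/andP; split.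
  apply: ge_inf; last by exists V => //; rewrite Vm.
  by exists 0 => _ [W _ <-].
apply: lb_le_inf; first by exists m%:R, V => //; rewrite Vm.
by move=> _ [W hW <-]; rewrite ler_nat mmin//; apply/asboolP; exists W.
Qed.

Lemma le_covN (rho rho' : R) : 0 < rho -> rho <= rho' ->
  covN n G rho' z <= covN n G rho z.
Proof.
move=> rho0 le; have [V hV ->] := covN_attained _ rho0.
apply: ge_inf; first by exists 0 => _ [W _ <-].
exists V => // g Gg y; have [v vV hv] := hV _ Gg y.
by exists v => // t; exact: le_trans (hv t) le.
Qed.

Lemma covN_ge1 (rho : R) : G !=set0 -> 0 < rho -> 1 <= covN n G rho z.
Proof.
move=> [g Gg] rho0; have [V hV ->] := covN_attained _ rho0.
have [v vV _] := hV _ Gg [tuple false | _ < n].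
by rewrite ler1n; case: V vV {hV}.
Qed.

End Covering.

(** * Comparing one chaining step with an integral *)

Lemma Rintegral_nonincreasing_split {R : realType} (f : R -> R) (a b c : R) :
  a <= b -> b <= c -> (forall x, a <= x -> 0 <= f x) ->
  (forall x y, a <= x -> x <= y -> f y <= f x) ->
  (b - a) * f b + Rintegral lebesgue_measure `[b, c] f
    <= Rintegral lebesgue_measure `[a, c] f.
Proof.
move=> ab bc f0 fd.
have intf : lebesgue_measure.-integrable `[a, c] (EFin \o f).
  apply: measurable_bounded_integrable => //=.
  - by rewrite lebesgue_measure_itv/=; case: ifP => _; rewrite ?ltry// -EFinB ltry.
  (* [f] is monotone only to the right of [a]; composing with [Order.max a] makes it monotone on the
     whole line, hence measurable. *)
  - have mf : measurable_fun `[a, c] (f \o Order.max a).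
      apply: measurable_realfun.nonincreasing_measurable => // x y xy /=.
      by apply: fd; rewrite ?ge_max !le_max lexx ?xy ?orbT.
    apply: eq_measurable_fun mf => x; rewrite inE/= in_itv/= => /andP[ax _].
    by rewrite max_r.
  - exists (f a); split; first exact: num_real.
    move=> M fM x /=; rewrite in_itv/= => /andP[ax _].
    by rewrite ger0_norm ?f0// (le_trans (fd _ _ _ ax))// ltW.
have intf' : lebesgue_measure.-integrable `[a, b] (EFin \o f).
  by apply: integrableS intf => //; apply: subset_itvl; rewrite bnd_simp.
have := @Rintegral_itvB R f (BLeft a) (BRight c) b intf.
rewrite !bnd_simp => /(_ ab bc).
rewrite Rintegral_itv_obnd_cbnd; last first.
  by apply: integrableS intf => //; apply: subset_itvr; rewrite bnd_simp.
move=> <-.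
suff : (b - a) * f b <= Rintegral lebesgue_measure `[a, b] f by lra.
rewrite (_ : (b - a) * f b = Rintegral lebesgue_measure `[a, b] (fun=> f b)).
  apply: le_Rintegral => //.
    apply: measurable_bounded_integrable => //=.
      by rewrite lebesgue_measure_itv/=; case: ifP => _; rewrite ?ltry// -EFinB ltry.
    exists (f b); split; first exact: num_real.
    by move=> M fM x _ /=; rewrite ger0_norm ?f0// ltW.
  by move=> x; rewrite /= in_itv/= => /andP[ax xb]; exact: fd.
rewrite Rintegral_cst// [LHS]mulrC; congr (_ * _).
apply: (etrans _ (congr1 fine (esym (lebesgue_measure_itv `[a, b])))).
rewrite /= lte_fin; case: ifPn => [//|].
by rewrite -leNgt => ba; apply/eqP; rewrite subr_eq0 eq_le ba ab.
Qed.

(** * Clipping and soft thresholding *)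

Definition clip {R : realType} (c x : R) : R :=
  if x < - c then - c else if c < x then c else x.

Lemma norm_clip_le {R : realType} (c x : R) : 0 <= c -> `|clip c x| <= c.
Proof.
move=> c0; rewrite /clip; case: ltP => h1; first by rewrite normrN ger0_norm.
by case: ltP => h2; [rewrite ger0_norm|rewrite ler_norml h1].
Qed.

Lemma clip_id {R : realType} (c x : R) : `|x| <= c -> clip c x = x.
Proof. by rewrite ler_norml /clip => /andP[h1 h2]; rewrite !ltNge h1 h2. Qed.

(** [x - clip c x] is the soft threshold of [x] at level [c]: it moves [x] towards 0 by the largest
    possible approximation error, so it cannot overshoot [a]. This turns a penalty on [a] into one
    on the approximation. *)
Lemma soft_threshold_le {R : realType} (c x a : R) :
  `|x - a| <= c -> `|x - clip c x| <= `|a|.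
Proof.
rewrite ler_norml => /andP[h1 h2]; have pa := ler_norm a.
have := ler_norm (- a); rewrite normrN /clip => na.
case: ltP => h3; first by rewrite ler_norml; apply/andP; split; lra.
case: ltP => h4; first by rewrite ler_norml; apply/andP; split; lra.
by rewrite subrr normr0.
Qed.

(** The price of that domination: the approximation error doubles. *)
Lemma soft_threshold_dist {R : realType} (c x a : R) :
  `|x - a| <= c -> `|x - clip c x - a| <= 2 * c.
Proof.
rewrite ler_norml => /andP[h1 h2]; rewrite /clip ler_norml.
by case: ltP => h3; [|case: ltP => h4]; apply/andP; split; lra.
Qed.

(** * Moments of a single increment *)

Section OneStep.
Context {R : realType}.
Implicit Types delta q w lam b : R.

Lemma mean_etaB q w : 0 < q < 1 ->
  q * (etaB q true * w) + (1 - q) * (etaB q false * w) = 0.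
Proof.
move=> /andP[q0 q1]; rewrite /etaB; field.
by rewrite subr_eq0 (gt_eqF q1) (gt_eqF q0).
Qed.

Lemma mean_norm_etaB q w : 0 < q < 1 ->
  q * (`|etaB q true| * w) + (1 - q) * (`|etaB q false| * w) = 2 * w.
Proof.
move=> /andP[q0 q1]; rewrite /etaB normrN !ger0_norm ?invr_ge0 ?subr_ge0 ?ltW//.
by field; rewrite subr_eq0 (gt_eqF q1) (gt_eqF q0).
Qed.

(** In the quadratic bound on the exponential the linear term has mean zero, and the second moment
    of eta is [q^-1 + (1 - q)^-1], at most [2 / delta]. *)
Lemma mean_expR_etaB delta q w lam b : 0 < delta -> delta <= q <= 1 - delta ->
  0 <= lam -> 0 < b -> lam * `|w| <= b * delta ->
  q * expR (lam * (etaB q true * w)) + (1 - q) * expR (lam * (etaB q false * w))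
  <= 1 + 2 * lam ^+ 2 * w ^+ 2 / delta * ((expR b - 1) / b).
Proof.
move=> d0 /andP[dq q1] lam0 b0 lw; set C := (expR b - 1) / b.
have C0 : 0 <= C.
  by rewrite divr_ge0 ?(ltW b0)//; have := expR_ge1Dx b; lra.
have q0 : 0 < q by lra.
have r0 : 0 < 1 - q by lra.
have bound u : delta <= u -> lam * `|w| / u <= b.
  by move=> du; rewrite ler_pdivrMr; [apply: (le_trans lw); rewrite ler_pM2l|lra].
have h1 : lam * (etaB q true * w) <= b.
  apply: le_trans (bound _ dq); apply: (le_trans (ler_norm _)).
  rewrite /etaB !normrM normrN normfV (ger0_norm lam0) (gtr0_norm q0).
  by rewrite mulrCA mulrC.
have h2 : lam * (etaB q false * w) <= b.
  apply: le_trans (bound (1 - q) _); last by lra.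
  apply: (le_trans (ler_norm _)).
  rewrite /etaB !normrM normfV (ger0_norm lam0) (gtr0_norm r0).
  by rewrite mulrCA mulrC.
have e1 := ler_wpM2l (ltW q0) (expR_le_quadratic _ _ b0 h1).
have e2 := ler_wpM2l (ltW r0) (expR_le_quadratic _ _ b0 h2).
apply: (le_trans (lerD e1 e2)); rewrite -/C /etaB.
rewrite [leLHS](_ : _ = 1 + (lam ^+ 2 * w ^+ 2 * C) * (q^-1 + (1 - q)^-1)); last first.
  by field; rewrite (gt_eqF q0) (gt_eqF r0).
rewrite lerD2l [leRHS](_ : _ = lam ^+ 2 * w ^+ 2 * C * (delta^-1 + delta^-1)); last by ring.
apply: ler_wpM2l; first exact: mulr_ge0 (mulr_ge0 (sqr_ge0 _) (sqr_ge0 _)) C0.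
by apply: lerD; rewrite lef_pV2 ?posrE//; lra.
Qed.

End OneStep.

(** * Maximal inequalities for finite families of trees *)

Section Stages.
Context {R : realType} {n : nat} {p : tree R} {delta : R}.
Hypotheses (hp : prob_tree n p) (delta0 : 0 < delta).

Lemma prob_inside t s : delta <= p t s <= 1 - delta -> 0 < p t s < 1.
Proof.
by move=> /andP[h1 h2]; rewrite (lt_le_trans delta0 h1) (le_lt_trans h2)// gtrBl.
Qed.

Definition eta_sum (w : tree R) (y : n.-tuple bool) : R :=
  \sum_(t < n | delta <= p t (take t y) <= 1 - delta)
    etaB (p t (take t y)) (tnth y t) * w t (take t y).

Definition penalized_sum (K : R) (w : tree R) (y : n.-tuple bool) : R :=
  \sum_(t < n | delta <= p t (take t y) <= 1 - delta)
    (etaB (p t (take t y)) (tnth y t) * w t (take t y) - K * w t (take t y) ^+ 2).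

Lemma eta_sumD (u w : tree R) y :
  eta_sum (fun t s => u t s + w t s) y = eta_sum u y + eta_sum w y.
Proof. by rewrite /eta_sum -big_split; apply: eq_bigr => t _; rewrite mulrDr. Qed.

Lemma eq_eta_sum (u w : tree R) (y : n.-tuple bool) :
  (forall t : 'I_n, u t (take t y) = w t (take t y)) -> eta_sum u y = eta_sum w y.
Proof. by move=> uw; apply: eq_bigr => t _; rewrite uw. Qed.

(** Serves the one-tree family, where zero entropy leaves no room for an error term. *)
Lemma Ep_eta_sum_le0 (w : tree R) : Ep p (eta_sum w) <= 0.
Proof.
rewrite -[leRHS](mulr0 n%:R).
apply: le_trans (Ep_sum_le _ _ (fun t s b => if delta <= p t s <= 1 - delta then
  etaB (p t s) b * w t s else 0) _ hp _).
  by apply: le_Ep => // y; rewrite /eta_sum big_mkcond.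
move=> t s; case: ifP => [h|_]; last by rewrite !mulr0 addr0.
by rewrite mean_etaB// prob_inside.
Qed.

(** The mean of |eta| is 2 whatever the probability, so no factor [delta^-1] appears. *)
Lemma Ep_eta_norm_le (c : R) : 0 <= c ->
  Ep p (fun y : n.-tuple bool => \sum_(t < n | delta <= p t (take t y) <= 1 - delta)
    `|etaB (p t (take t y)) (tnth y t)| * c) <= n%:R * (2 * c).
Proof.
move=> c0.
apply: le_trans (Ep_sum_le _ _ (fun t s b => if delta <= p t s <= 1 - delta then
  `|etaB (p t s) b| * c else 0) _ hp _).
  by apply: le_Ep => // y; rewrite big_mkcond.
move=> t s; case: ifP => [h|_]; last by rewrite !mulr0 addr0 mulr_ge0.
by rewrite mean_norm_etaB// prob_inside.
Qed.

(** The exponents stay below [3 / 2], where the quadratic coefficient is at most 3; with the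
    variance factor 2 this gives the constant 6. *)
Lemma Ep_expR_eta_sum_le (w : tree R) (lam c : R) : 0 <= lam -> 0 <= c ->
  (forall t s, `|w t s| <= c) -> lam * c <= 3 / 2 * delta ->
  Ep p (fun y => expR (lam * eta_sum w y))
    <= expR (n%:R * (6 * lam ^+ 2 * c ^+ 2 / delta)).
Proof.
move=> lam0 c0 wc lc.
apply: le_trans (Ep_expR_sum_le _ _ (fun t s b =>
  if delta <= p t s <= 1 - delta then lam * (etaB (p t s) b * w t s) else 0) _ hp _).
  by apply: le_Ep => // y; rewrite /eta_sum mulr_sumr big_mkcond.
have k0 : 0 <= 6 * lam ^+ 2 * c ^+ 2 / delta.
  by rewrite !mulr_ge0 ?sqr_ge0// invr_ge0 ltW.
move=> t s; apply: le_trans (expR_ge1Dx _).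
case: ifP => [h|_]; last by rewrite expR0; lra.
have lw : lam * `|w t s| <= 3 / 2 * delta.
  by apply: le_trans lc; exact: ler_wpM2l.
have b0 : 0 < 3 / 2 :> R by lra.
apply: (le_trans (mean_expR_etaB _ _ _ _ _ delta0 h lam0 b0 lw)); rewrite lerD2l.
have wc2 : w t s ^+ 2 <= c ^+ 2.
  by rewrite -(real_normK (num_real (w t s))) lerXn2r ?nnegrE.
have C3 : (expR (3 / 2) - 1) / (3 / 2) <= 3 :> R.
  by rewrite ler_pdivrMr//; have := @expR_three_halves_le R; lra.
rewrite [leRHS](_ : _ = 2 * lam ^+ 2 * c ^+ 2 / delta * 3); last by ring.
apply: ler_pM => //.
  by rewrite divr_ge0 ?(ltW delta0)// mulr_ge0 ?sqr_ge0// mulr_ge0 ?sqr_ge0.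
by rewrite ler_pM2r ?invr_gt0// ler_wpM2l// mulr_ge0 ?sqr_ge0.
Qed.

Lemma fast_stage (W : seq (tree R)) (N K : R) : 0 < K -> 1 <= N ->
  (size W)%:R <= N -> (forall w, w \in W -> forall t s, `|w t s| <= 1) ->
  exists2 M : n.-tuple bool -> R,
    (forall w, w \in W -> forall y,
       penalized_sum K w y <= M y) &
    Ep p M <= delta^-1 * (ln N / ln (1 + K / 8)).
Proof.
move=> K0 N1 WN w1; set ell := ln (1 + K / 8).
have ell0 : 0 < ell by rewrite ln_gt0//; lra.
have lam0 : 0 < delta * ell by rewrite mulr_gt0.
have WL : (size W)%:R <= expR (ln N).
  by rewrite lnK// posrE; lra.
have := @soft_max R n p _ W (penalized_sum K) (delta * ell) (ln N) 0 hp lam0 WL.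
case=> [w wW|M hM EM]; last first.
  by exists M => //; apply: (le_trans EM); rewrite addr0 invfM mulrCA.
rewrite -[X in expR X](mulr0 n%:R).
apply: le_trans (Ep_expR_sum_le _ _ (fun t s b =>
  if delta <= p t s <= 1 - delta
  then delta * ell * (etaB (p t s) b * w t s - K * w t s ^+ 2) else 0) _ hp _).
  by apply: le_Ep => // y; rewrite /penalized_sum mulr_sumr big_mkcond.
move=> t s; rewrite expR0; case: ifP => [h|_]; last by rewrite expR0; lra.
have lw : delta * ell * `|w t s| <= ell * delta.
  by rewrite [leRHS]mulrC ler_piMr ?(ltW lam0)// w1.
have := mean_expR_etaB _ _ _ _ _ delta0 h (ltW lam0) ell0 lw.
rewrite (lnK (_ : 1 + K / 8 \in Num.pos)); last by rewrite posrE; lra.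
set E1 := expR _; set E2 := expR _ => hE.
set k := delta * ell * (K * w t s ^+ 2).
have k0 : 0 <= k := mulr_ge0 (ltW lam0) (mulr_ge0 (ltW K0) (sqr_ge0 _)).
have hk : p t s * E1 + (1 - p t s) * E2 <= expR k.
  (* At this exponent the variance term is exactly [k / 4], while the penalty contributes the factor
     [expR (- k)], which more than absorbs it. *)
  apply: le_trans (expR_ge1Dx _); apply: (le_trans hE); rewrite lerD2l.
  rewrite [leLHS](_ : _ = k / 4); last by rewrite /k; field; rewrite !gt_eqF.
  lra.
rewrite !mulrBr !(expRD _ (- _)) -/E1 -/E2 -/k !mulrA -mulrDl expRN.
by rewrite ler_pdivrMr ?expR_gt0// mul1r.
Qed.

(* The constants come from [lam = 1 / (2 c / (3 delta) + 7 c s / (4 q))] with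
   [q = sqrt (2 ln N)]: the first summand keeps [lam c / delta <= 3 / 2] and the
   second one balances the two square-root terms. *)
Lemma chaining_stage (W : seq (tree R)) (N c : R) : 1 <= N -> 0 < c ->
  (size W)%:R <= N ^+ 2 -> (forall w, w \in W -> forall t s, `|w t s| <= c) ->
  exists2 M : n.-tuple bool -> R,
    (forall w, w \in W -> forall y, eta_sum w y <= M y) &
    Ep p M <= 5 * c * Num.sqrt (2 * n%:R / delta) * Num.sqrt (ln N)
              + 4 / 3 * c / delta * ln N.
Proof.
(* Zero entropy is separate, since [q] below would vanish: then [N = 1] and [W] has at most one
   tree. *)
move=> N1 c0 WN wc; have [l0|l0] := leP (ln N) 0.
  have N1' : N = 1.
    by apply/le_anti; rewrite N1 andbT leNgt; apply/negP => /ln_gt0; rewrite ltNge l0.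
  move: WN; rewrite N1' ln1 sqrtr0 !mulr0 addr0 expr1n.
  case: W wc => [|w [|w' W]] wc.
  - by exists (fun=> 0) => //; rewrite Ep_cst.
  - by exists (eta_sum w) => [u|]; [rewrite inE => /eqP ->|rewrite Ep_eta_sum_le0].
  - by rewrite (ler_nat _ _ 1).
set s := Num.sqrt (2 * n%:R / delta); set l := ln N.
rewrite -/l in l0.
have s0 : 0 <= s by exact: sqrtr_ge0.
have s2 : s ^+ 2 = 2 * n%:R / delta.
  by rewrite sqr_sqrtr// divr_ge0 ?mulr_ge0// ltW.
pose q := Num.sqrt (2 * l).
have q0 : 0 < q by rewrite sqrtr_gt0 mulr_gt0.
have q2 : q ^+ 2 = 2 * l by rewrite sqr_sqrtr// mulr_ge0// ltW.
have ql : q <= 10 / 7 * Num.sqrt l.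
  rewrite -(@ler_pXn2r _ 2) ?nnegrE ?(ltW q0) ?mulr_ge0 ?sqrtr_ge0//.
  by rewrite q2 exprMn sqr_sqrtr ?(ltW l0)//; lra.
pose a := c / delta * (2 / 3); pose d := 7 / 4 * c * s / q.
have a0 : 0 < a by rewrite !mulr_gt0 ?invr_gt0.
have d0 : 0 <= d by rewrite !mulr_ge0 ?invr_ge0// ltW.
have lam0 : 0 < (a + d)^-1 by rewrite invr_gt0; lra.
have WL : (size W)%:R <= expR (2 * l).
  by rewrite expRM_natl lnK// posrE; lra.
have [w wW|M hM EM] := @soft_max R n p _ W eta_sum (a + d)^-1 (2 * l)
    (n%:R * (6 * (a + d)^-1 ^+ 2 * c ^+ 2 / delta)) hp lam0 WL.
  apply: Ep_expR_eta_sum_le; rewrite ?(ltW lam0) ?(ltW c0)//; first exact: wc.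
  rewrite ler_pdivrMl; last by lra.
  have -> : c = a * (3 / 2 * delta) by rewrite /a; field; rewrite gt_eqF.
  by rewrite ler_pM2r; [lra|rewrite mulr_gt0].
exists M => //; apply: (le_trans EM).
rewrite invrK mulrDl [X in _ + X](_ : _ = 3 * (c * s) * ((a + d)^-1 * (c * s))); last first.
  rewrite (_ : 3 * _ * _ = 3 * (a + d)^-1 * c ^+ 2 * s ^+ 2); last by ring.
  by rewrite s2; field; rewrite !gt_eqF//; lra.
have h1 : (a + d)^-1 * (c * s) <= 4 / 7 * q.
  rewrite ler_pdivrMl; last by lra.
  have -> : c * s = d * (4 / 7 * q) by rewrite /d; field; rewrite gt_eqF.
  by rewrite ler_pM2r; [lra|rewrite mulr_gt0].
have h2 : 2 * l * (a + d) = 4 / 3 * c / delta * l + 7 / 4 * (c * s) * q.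
  have -> : l = q ^+ 2 / 2 by rewrite q2; field.
  by rewrite /a /d; field; rewrite !gt_eqF.
rewrite h2.
have cs0 : 0 <= c * s by rewrite mulr_ge0// ltW.
(* The square-root terms add up to [(7 / 4 + 12 / 7) * (c * s) * q]; as [q <= 10 / 7 * Num.sqrt l],
   the constant stays below 5. *)
have h3 := ler_wpM2l (mulr_ge0 (_ : 0 <= 3) cs0) h1.
have h4 := ler_wpM2l cs0 ql.
have := mulr_ge0 cs0 (sqrtr_ge0 l).
move: (h3 (ler0n _ _)) h4; lra.
Qed.

End Stages.

(** * Chaining along dyadic scales *)

Section Chaining.
Context {R : realType} {Z : Type} {delta : R} {G : set (Z -> R)} {n : nat}.
Context {p : tree R} {z : tree Z} {K gamma : R}.
Hypotheses (delta0 : 0 < delta) (G0 : G !=set0).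
Hypothesis G1 : forall g, G g -> forall x, -1 <= g x <= 1.
Hypotheses (hp : prob_tree n p) (K0 : 0 < K) (gamma0 : 0 < gamma).

Notation scale k := (gamma / 2 ^+ k).
Notation entropy rho := (ln (covN n G rho z)).
Notation sqrt_integral a :=
  (Rintegral lebesgue_measure `[a, gamma] (fun rho => Num.sqrt (entropy rho))).
Notation entropy_integral a :=
  (Rintegral lebesgue_measure `[a, gamma] (fun rho => entropy rho)).
Notation eta_sum := (@eta_sum R n p delta).
Notation penalized_sum := (@penalized_sum R n p delta).

Lemma scale_gt0 k : 0 < scale k.
Proof. by rewrite divr_gt0// exprn_gt0. Qed.

Lemma scaleS k : scale k = 2 * scale k.+1.
Proof. by rewrite exprS; field; rewrite expf_neq0. Qed.

Lemma le_scale k : scale k <= gamma.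
Proof.
by rewrite ler_pdivrMr ?exprn_gt0// ler_peMr ?(ltW gamma0)// exprn_ege1// ler1n.
Qed.

Lemma entropy_ge0 rho : 0 < rho -> 0 <= entropy rho.
Proof. by move=> rho0; rewrite ln_ge0// covN_ge1. Qed.

Lemma le_entropy rho rho' : 0 < rho -> rho <= rho' -> entropy rho' <= entropy rho.
Proof.
move=> rho0 le; have h r : 0 < r -> 0 < covN n G r z.
  by move=> r0; exact: lt_le_trans ltr01 (covN_ge1 G1 _ G0 r0).
by rewrite ler_ln ?posrE ?h ?(lt_le_trans rho0 le)// le_covN.
Qed.

Lemma integrals_split a b : 0 < a -> a <= b -> b <= gamma ->
  (b - a) * Num.sqrt (entropy b) + sqrt_integral b <= sqrt_integral a /\
  (b - a) * entropy b + entropy_integral b <= entropy_integral a.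
Proof.
move=> a0 ab bg; split; apply: Rintegral_nonincreasing_split => //.
- by move=> x y ax xy; apply: ler_wsqrtr; apply: le_entropy => //; exact: lt_le_trans ax.
- by move=> x ax; apply: entropy_ge0; exact: lt_le_trans ax.
- by move=> x y ax xy; apply: le_entropy => //; exact: lt_le_trans ax.
Qed.

(** The target bound at [a] without its term linear in [n * a], which arises only from stopping the
    chain. *)
Definition chain_bound (a : R) : R :=
  delta^-1 * (entropy gamma / ln (1 + K / 8))
  + 30 * Num.sqrt (2 * n%:R / delta) * sqrt_integral a
  + 8 / delta * entropy_integral a.

(* [u] is within twice the scale: at [k = 0] it is a soft-thresholded covering
   element (so that the negative quadratic term survives), and at [k > 0] it
   comes from the cover at the previous scale [2 * scale k]. *)
Definition chained (k : nat) (M : n.-tuple bool -> R) (U : seq (tree R)) : Prop :=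
  forall g, G g -> forall y : n.-tuple bool, exists2 u, u \in U &
    (forall t : 'I_n, `|u t (take t y) - g (z t (take t y))| <= 2 * scale k) /\
    penalized_sum K (fun t s => g (z t s)) y
      <= M y + eta_sum (fun t s => g (z t s) - u t s) y.

Lemma chain_start : exists M U,
  [/\ (size U)%:R <= covN n G (scale 0) z, chained 0 M U
    & Ep p M <= chain_bound (scale 0)].
Proof.
rewrite /chained expr0 divr1.
have [V hV VN] := covN_attained G1 _ gamma0 (n := n) (z := z).
(* The inner clip performs the soft thresholding. The outer one ensures the bound 1 at every node
   and is inactive on the path, where the thresholded value is dominated by |g|. *)
pose th (v : tree R) : tree R := fun t s => clip 1 (v t s - clip gamma (v t s)).
have N1 := covN_ge1 G1 _ G0 gamma0 (n := n) (z := z).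
have sU : (size (map th V))%:R <= covN n G gamma z by rewrite size_map VN.
have [w /mapP[v _ ->] t s|M hM EM] := fast_stage hp delta0 _ _ _ K0 N1 sU.
  by apply: norm_clip_le; exact: ler01.
exists M, (map th V); split => //; last first.
  apply: (le_trans EM); rewrite /chain_bound -addrA lerDl.
  apply: addr_ge0; apply: mulr_ge0.
  - by rewrite mulr_ge0// sqrtr_ge0.
  - by apply: Rintegral_ge0 => x _; exact: sqrtr_ge0.
  - by rewrite divr_ge0// ltW.
  - apply: Rintegral_ge0 => x /=; rewrite in_itv/= => /andP[gx _].
    by apply: entropy_ge0; exact: lt_le_trans gx.
move=> g Gg y; have [v vV hv] := hV _ Gg y.
have thE (t : 'I_n) : th v t (take t y) = v t (take t y) - clip gamma (v t (take t y)).
  apply: clip_id; apply: (le_trans (soft_threshold_le _ _ _ (hv t))).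
  by rewrite ler_norml; exact: G1.
exists (th v); first exact: map_f.
split; first by move=> t; rewrite thE; exact: soft_threshold_dist.
apply: (@le_trans _ _ (penalized_sum K (th v) y +
                       eta_sum (fun t s => g (z t s) - th v t s) y)); last first.
  by rewrite lerD2r; apply: hM; exact: map_f.
(* The linear parts agree exactly; only the squares have to be compared. *)
rewrite -big_split/=; apply: ler_sum => t _; rewrite thE.
set x := v t _ - _; set e := etaB _ _; set gt := g _.
have : x ^+ 2 <= gt ^+ 2.
  rewrite -(real_normK (num_real x)) -(real_normK (num_real gt)).
  by rewrite lerXn2r ?nnegrE// soft_threshold_le.
move=> /(ler_wpM2l (ltW K0)); lra.
Qed.

(** The new trees cover at [scale k], which is [2 * scale k.+1]. The entropy paid is thus the one at
    [scale k], the least value of the integrand on [[scale k.+1, scale k]], so the step fits under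
    the integral. *)
Lemma chain_step k M U : (size U)%:R <= covN n G (scale k) z -> chained k M U ->
  Ep p M <= chain_bound (scale k) ->
  exists M' U', [/\ (size U')%:R <= covN n G (scale k.+1) z, chained k.+1 M' U'
    & Ep p M' <= chain_bound (scale k.+1)].
Proof.
move=> sU hU EM; have r0 := scale_gt0 k.
have r1 := scale_gt0 k.+1; have rS := scaleS k.
have [V hV VN] := covN_attained G1 _ r0 (n := n) (z := z).
have N1 := covN_ge1 G1 _ G0 r0 (n := n) (z := z).
pose df (v u : tree R) : tree R := fun t s => clip (3 * scale k) (v t s - u t s).
(* On the path [v] is within [scale k] of [g] and [u] within [2 * scale k]. *)
have c0 : 0 < 3 * scale k by lra.
have sW : (size [seq df v u | v <- V, u <- U])%:R <= covN n G (scale k) z ^+ 2.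
  by rewrite size_allpairs natrM expr2 ler_pM// VN.
have [w /allpairsP[[v u] [_ _ ->]] t s|M' hM' EM'] :=
    chaining_stage hp delta0 _ _ _ N1 c0 sW.
  by apply: norm_clip_le; exact: ltW.
exists (fun y => M y + M' y), V; split.
- by rewrite -VN le_covN//; lra.
- move=> g Gg y; have [u uU [hu hM]] := hU _ Gg y; have [v vV hv] := hV _ Gg y.
  exists v => //; split; first by move=> t; rewrite -rS; exact: hv.
  apply: (le_trans hM); rewrite -addrA lerD2l.
  have -> : eta_sum (fun t s => g (z t s) - u t s) y =
      eta_sum (df v u) y + eta_sum (fun t s => g (z t s) - v t s) y.
    rewrite -eta_sumD; apply: eq_eta_sum => t; rewrite /df clip_id; first by ring.
    apply: (le_trans (ler_distD (g (z t (take t y))) _ _)).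
    rewrite (_ : 3 * scale k = scale k + 2 * scale k); last by ring.
    by apply: lerD; [exact: hv|rewrite distrC; exact: hu].
  rewrite lerD2r; apply: hM'.
  by apply/allpairsP; exists (v, u).
rewrite EpD; apply: (le_trans (lerD EM EM')).
have rr : scale k.+1 <= scale k by lra.
have [h1 h2] := integrals_split _ _ r1 rr (le_scale k).
have s0 : 0 <= 30 * Num.sqrt (2 * n%:R / delta) by rewrite mulr_ge0// sqrtr_ge0.
have d0 : 0 <= 8 / delta by rewrite divr_ge0// ltW.
have := ler_wpM2l s0 h1; have := ler_wpM2l d0 h2.
(* The step costs [5 * 3] and [4 / 3 * 3] times [scale k]; the interval has length [scale k / 2],
   whence the constants 30 and 8. *)
rewrite /chain_bound (_ : scale k - scale k.+1 = scale k / 2); last by lra.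
lra.
Qed.

Lemma chain k : exists M U,
  [/\ (size U)%:R <= covN n G (scale k) z, chained k M U
    & Ep p M <= chain_bound (scale k)].
Proof.
elim: k => [|k [M [U [sU hU EM]]]]; first exact: chain_start.
exact: chain_step sU hU EM.
Qed.

Lemma scale_bracket alpha : 0 < alpha <= gamma ->
  exists k, scale k.+1 < alpha <= scale k.
Proof.
move=> /andP[a0 ag].
have exk : exists k, scale k < alpha.
  have := archi_boundP (divr_ge0 (ltW gamma0) (ltW a0)).
  set m := Num.bound _ => hm; exists m.
  rewrite ltr_pdivrMr ?exprn_gt0// mulrC -ltr_pdivrMr//.
  by apply: (lt_le_trans hm); rewrite -natrX ler_nat ltnW// ltn_expl.
(* The first scale below [alpha] is not [scale 0], because [alpha <= gamma]; its predecessor is the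
   stopping scale. *)
have [[|k] hk kmin] := ex_minnP exk.
  by move: hk; rewrite expr0 divr1 ltNge ag.
by exists k; rewrite hk leNgt; apply/negP => /kmin; rewrite ltnn.
Qed.

End Chaining.

(** * Stopping the chain at [alpha] *)

Theorem theorem2 (R : realType) (Z : Type) (delta : R) (G : set (Z -> R))
  (n : nat) (p : tree R) (z : tree Z) (K gamma : R) :
  0 < delta < 1 / 2 ->
  G !=set0 ->
  (forall g, G g -> forall x, -1 <= g x <= 1) ->
  (forall (t : nat) (s : seq bool), (t < n)%N -> size s = t -> 0 <= p t s <= 1) ->
  0 < K -> 0 < gamma ->
  Ep p (fun y : n.-tuple bool =>
    sup [set (\sum_(t < n | delta <= p t (take t y) <= 1 - delta)
               (etaB (p t (take t y)) (tnth y t) * g (z t (take t y))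
                - K * g (z t (take t y)) ^+ 2)) | g in G])
  <= delta^-1 * (ln (covN n G gamma z) / ln (1 + K / 8))
     + inf [set 4 * n%:R * alpha / delta
                + 30 * Num.sqrt (2 * n%:R / delta)
                    * Rintegral lebesgue_measure `[alpha, gamma]
                        (fun rho => Num.sqrt (ln (covN n G rho z)))
                + 8 / delta
                    * Rintegral lebesgue_measure `[alpha, gamma]
                        (fun rho => ln (covN n G rho z))
           | alpha in `]0, gamma]].
Proof.
move=> /andP[delta0 delta2] G0 G1 hp K0 gamma0.
rewrite -lerBlDl; apply: lb_le_inf.
  by eexists; exists gamma => //=; rewrite in_itv/= gamma0 lexx.
move=> _ [alpha /= + <-]; rewrite in_itv/= => a_itv; rewrite lerBlDl.
have [k /andP[ka ak]] := scale_bracket gamma0 _ a_itv.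
have /andP[a0 _] := a_itv.
have r0 := scale_gt0 gamma0 k.
have [M [U [_ hU EM]]] := chain delta0 G0 G1 hp K0 gamma0 (z := z) k.
(* [r] bounds the distance from [g] to its last approximation on the path; [rest] bounds the
   unresolved sum uniformly in [g]. *)
pose r := 2 * (gamma / 2 ^+ k); have r2 : 0 <= r by rewrite /r; lra.
pose rest (y : n.-tuple bool) := \sum_(t < n | delta <= p t (take t y) <= 1 - delta)
    `|etaB (p t (take t y)) (tnth y t)| * r.
apply: (@le_trans _ _ (Ep p (fun y => M y + rest y))).
  apply: le_Ep => // y; apply: ge_sup.
    by have [g Gg] := G0; eexists; exists g.
  move=> _ [g Gg <-]; have [u _ [hu hM]] := hU _ Gg y.
  apply: (le_trans hM); rewrite lerD2l; apply: ler_sum => t _.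
  apply: (le_trans (ler_norm _)); rewrite normrM ler_wpM2l//.
  by rewrite distrC; exact: hu.
rewrite EpD; have hrest := Ep_eta_norm_le hp delta0 _ r2.
have [h1 h2] := integrals_split G0 G1 (n := n) (z := z) _ _ a0 ak (le_scale gamma0 k).
have ra : 0 <= gamma / 2 ^+ k - alpha by rewrite subr_ge0.
have h1' := ler_wpM2l (_ : 0 <= 30 * Num.sqrt (2 * n%:R / delta))
  (le_trans (ler_wpDl (mulr_ge0 ra (sqrtr_ge0 _)) (lexx _)) h1).
have h2' := ler_wpM2l (_ : 0 <= 8 / delta)
  (le_trans (ler_wpDl (mulr_ge0 ra (entropy_ge0 G0 G1 _ r0)) (lexx _)) h2).
(* [2 * r] is 8 times the next scale, which is below [alpha]; then [delta < 1 / 2] gives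
   [8 <= 4 / delta]. *)
have hr : n%:R * (2 * r) <= 4 * n%:R * alpha / delta.
  apply: (@le_trans _ _ (n%:R * (8 * alpha))).
    rewrite ler_wpM2l// /r; have := scaleS k (gamma := gamma); lra.
  rewrite ler_pdivlMr//.
  have := mulr_ge0 (mulr_ge0 (ler0n R n) (ltW a0)) (_ : 0 <= 1 - 2 * delta).
  lra.
move: (h1' (mulr_ge0 (ler0n _ _) (sqrtr_ge0 _))) (h2' (divr_ge0 (ler0n _ _) (ltW delta0))).
move: EM hrest; rewrite /chain_bound -/(rest _); lra.
Qed.
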